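(* Let $y>0$. The boundary-value problem $$\begin{cases}\dfrac{\partial^2 u}{\partial t^2}(x,t)=-\dfrac{1}{2^2}\dfrac{\partial^4 u}{\partial x^4}(x,t), & x>0,\ t>0,\\ u(x,0)=\delta(x-y),\\ u_t(x,0)=0,\\ u(0,t)=0\end{cases}$$ has solution $$u^a(x,t;y,0)=\frac{1}{\sqrt{2\pi t}}\left[\cos\left(\frac{(x-y)^2}{2t}-\frac{\pi}{4}\right)-\cos\left(\frac{(x+y)^2}{2t}-\frac{\pi}{4}\right)\right].$$
   Context: $\delta$ is the Dirac delta. The initial conditions are understood in the sense of distributions on $(0,\infty)$: as $t\to0^+$, $u(\cdot,t)\to\delta(\cdot-y)$ and $u_t(\cdot,t)\to0$. ''Has solution'' means that the displayed function satisfies the listed equation and conditions; no uniqueness class is specified. *)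

(* Defs.v *)
From Stdlib Require Import Reals.
From Coquelicot Require Import Coquelicot.
Open Scope R_scope.

(** Real-valued elements of C_c^infinity((0,+oo)), extended by zero to R. *)
Definition test_function (phi : R -> R) : Prop :=
  (forall (n : nat) (x : R), ex_derive_n phi n x) /\
  exists a b : R, 0 < a /\ a < b /\ forall x : R, x < a \/ b < x -> phi x = 0.

Definition distribution_functional : Type := (R -> R) -> R.

Definition dirac (y : R) : distribution_functional := fun phi => phi y.

Definition zero_distribution : distribution_functional := fun _ => 0.

(** Convergence v(.,t) -> T, as t -> 0+, in the sense of distributions on
    (0,+oo). The existence of every pairing [I t] is part of the claim. *)
Definition converges_in_distributions
    (v : R -> R -> R) (T : distribution_functional) : Prop :=
  forall phi : R -> R, test_function phi ->
  exists I : R -> R,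
    (forall t : R, 0 < t ->
       is_RInt_gen (fun x => v x t * phi x)
         (at_right 0) (Rbar_locally p_infty) (I t)) /\
    filterlim I (at_right 0) (locally (T phi)).

(** [Derive] and [Derive_n] are total, so the existence of all the derivatives
    involved is required separately. The boundary value at x = 0 is required
    both pointwise and as the limit from inside the domain. *)
Record is_solution (y : R) (u : R -> R -> R) : Prop := {
  solution_ex_derive_t : forall (k : nat) (x t : R),
    (k <= 2)%nat -> 0 < x -> 0 < t -> ex_derive_n (fun s => u x s) k t;
  solution_ex_derive_x : forall (k : nat) (x t : R),
    (k <= 4)%nat -> 0 < x -> 0 < t -> ex_derive_n (fun z => u z t) k x;
  solution_pde : forall x t : R, 0 < x -> 0 < t ->
    Derive_n (fun s => u x s) 2 t
    = - (1 / 2 ^ 2) * Derive_n (fun z => u z t) 4 x;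
  solution_initial_value :
    converges_in_distributions u (dirac y);
  solution_initial_velocity :
    converges_in_distributions
      (fun x t => Derive (fun s => u x s) t) zero_distribution;
  solution_boundary_value : forall t : R, 0 < t -> u 0 t = 0;
  solution_boundary_limit : forall t : R, 0 < t ->
    filterlim (fun x => u x t) (at_right 0) (locally 0)
}.

(** u^a(x,t;y,0) *)
Definition ua (y x t : R) : R :=
  1 / sqrt (2 * PI * t) *
  (cos ((x - y) ^ 2 / (2 * t) - PI / 4)
   - cos ((x + y) ^ 2 / (2 * t) - PI / 4)).

(* Main.v *)
Require Import Defs.
From Stdlib Require Import Reals Lra Lia.
From Coquelicot Require Import Coquelicot.
From Corelib Require Import ssreflect.
Unset SsrRewrite.
Open Scope R_scope.

(** With [kernel th t z = cos (z ^ 2 / (2 t) - th) / sqrt (2 pi t)], the function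
    [ua] is [kernel (pi/4) t (x - y) - kernel (pi/4) t (x + y)]: the solution on
    the whole line issued from a point mass at [y], minus its mirror image,
    which enforces the boundary condition at [0].

    The kernel is the real part of [exp (- i th)] times the free Schroedinger
    wave [psi = exp (i z ^ 2 / (2 t)) / sqrt (2 pi t)], which satisfies
    [psi_t = (i / 2) psi_zz]. A quarter turn of the phase is a multiplication by
    [- i], so in real form
      [d/dt kernel th = - (1/2) d^2/dz^2 kernel (th + pi/2)]
    ([is_derive_kernel_t], [is_derive_kernel_xx_t]). Applying this identity twice
    turns the phase by [pi], that is, changes the sign, and yields the beam
    equation [u_tt = - (1/4) u_xxxx].

    The initial conditions are a stationary phase statement: for [f] of
    class C^2 vanishing to first order at the ends of an interval
    containing [c], the integral of [kernel th t (x - c) * f x] tends to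
    [2 L(th) / sqrt (2 pi) * f c] as [t] tends to [0], where [L(th)] is the
    improper integral of [cos (u ^ 2 / 2 - th)] over the positive half line.
    The kernel is the second derivative in [x] of
    [sqrt t * D ((x - c) / sqrt t) / sqrt (2 pi)], where [D] is a second
    primitive of [cos (s ^ 2 / 2 - th)], and [D s = L(th) |s| + O(1)]. Two
    integrations by parts therefore replace the kernel by
    [L(th) / sqrt (2 pi) * |x - c| + O(sqrt t)] paired with [f''], and [|x - c|]
    is twice a fundamental solution of the second derivative
    ([kernel_pairing_estimate]). The mirror image contributes [f (- y) = 0].

    The values needed are [L(pi/4) = sqrt (2 pi) / 2], which makes the weak limit
    the point mass, and [L(3 pi/4) = 0], which makes the velocity vanish, because
    the velocity is [- 1/2] times the second [x]-derivative of the kernel with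
    phase [3 pi/4] and the two derivatives can be moved onto the test function.
    They are found with the analogue of the classical evaluation of the Gaussian
    integral ([fresnel_product_phase_average], [fresnel_limit_product]): with
    [F s] the integral of [exp (i u ^ 2 / 2)] over [[0, s]],
      [F s ^ 2 + 2 i G s = 2 i G 0 = i pi / 2],
    where [G s] is the integral of [exp (i s ^ 2 (1 + v ^ 2) / 2) / (1 + v ^ 2)]
    over [[0, 1]] and tends to [0]. *)

(** * Real analysis *)

Lemma increment_le_increment (f g df dg : R -> R) (a b : R) : a <= b ->
  (forall x, a <= x <= b -> is_derive f x (df x)) ->
  (forall x, a <= x <= b -> is_derive g x (dg x)) ->
  (forall x, a <= x <= b -> df x <= dg x) -> f b - f a <= g b - g a.
Proof.
intros hab hf hg hle.
destruct (MVT_gen (fun x => g x - f x) a b (fun x => dg x - df x))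
  as [c [hc e]].
- intros x hx; rewrite Rmin_left, Rmax_right in hx by lra.
  apply: is_derive_minus; [apply hg | apply hf]; lra.
- intros x hx; rewrite Rmin_left, Rmax_right in hx by lra.
  apply derivable_continuous_pt; exists (dg x - df x); apply is_derive_Reals.
  apply: is_derive_minus; [apply hg | apply hf]; lra.
- rewrite Rmin_left, Rmax_right in hc by lra.
  assert (h := hle c hc).
  assert (0 <= (dg c - df c) * (b - a)) by (apply Rmult_le_pos; lra).
  lra.
Qed.

Lemma Rabs_increment_le (f g df dg : R -> R) (a b : R) : a <= b ->
  (forall x, a <= x <= b -> is_derive f x (df x)) ->
  (forall x, a <= x <= b -> is_derive g x (dg x)) ->
  (forall x, a <= x <= b -> Rabs (df x) <= dg x) ->
  Rabs (f b - f a) <= g b - g a.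
Proof.
intros hab hf hg hle; apply Rabs_le; split.
- enough (- f b - - f a <= g b - g a) by lra.
  apply (increment_le_increment (fun x => - f x) g (fun x => - df x) dg);
    auto.
  + intros x hx; apply: is_derive_opp; auto.
  + intros x hx; assert (h := hle x hx); apply Rabs_le_between in h; lra.
- apply (increment_le_increment f g df dg); auto.
  intros x hx; assert (h := hle x hx); apply Rabs_le_between in h; lra.
Qed.

Lemma continuous_of_ex_derive (f : R -> R) (x : R) :
  ex_derive f x -> continuous f x.
Proof. intros h; now apply: ex_derive_continuous. Qed.

(** * Fresnel integrals with a phase *)

Definition fresnel (th s : R) : R := RInt (fun u => cos (u ^ 2 / 2 - th)) 0 s.

Lemma continuous_fresnel_integrand (th u : R) :
  continuous (fun u => cos (u ^ 2 / 2 - th)) u.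
Proof. apply continuous_of_ex_derive; auto_derive; auto. Qed.

Lemma is_RInt_fresnel (th s : R) :
  is_RInt (fun u => cos (u ^ 2 / 2 - th)) 0 s (fresnel th s).
Proof.
apply: RInt_correct; apply: ex_RInt_continuous => u _.
apply continuous_fresnel_integrand.
Qed.

Lemma is_derive_fresnel (th s : R) :
  is_derive (fresnel th) s (cos (s ^ 2 / 2 - th)).
Proof.
apply (is_derive_RInt (fun u => cos (u ^ 2 / 2 - th)) (fresnel th) 0).
- apply filter_forall => b; apply is_RInt_fresnel.
- apply continuous_fresnel_integrand.
Qed.

Lemma fresnel_0 (th : R) : fresnel th 0 = 0.
Proof. apply: RInt_point. Qed.

Lemma fresnel_opp (th s : R) : fresnel th (- s) = - fresnel th s.
Proof.
apply is_RInt_unique.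
assert (h : is_RInt (fun u => cos (u ^ 2 / 2 - th)) (-1 * 0 + 0) (-1 * - s + 0)
  (fresnel th s)).
{ assert (e0 : -1 * 0 + 0 = 0) by ring.
  assert (e1 : -1 * - s + 0 = s) by ring.
  rewrite e0, e1; apply is_RInt_fresnel. }
apply is_RInt_comp_lin, is_RInt_opp in h.
eapply is_RInt_ext; [|exact h]; intros u _; simpl.
change (- (-1 * cos ((-1 * u + 0) ^ 2 / 2 - th)) = cos (u ^ 2 / 2 - th)).
replace ((-1 * u + 0) ^ 2) with (u ^ 2) by ring; ring.
Qed.

Lemma fresnel_shift_PI (th s : R) : fresnel (th + PI) s = - fresnel th s.
Proof.
apply is_RInt_unique.
eapply is_RInt_ext; [|exact (is_RInt_opp _ _ _ _ (is_RInt_fresnel th s))].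
intros u _; change (- cos (u ^ 2 / 2 - th) = cos (u ^ 2 / 2 - (th + PI))).
assert (e : u ^ 2 / 2 - th = u ^ 2 / 2 - (th + PI) + PI) by ring.
rewrite e, neg_cos; apply Ropp_involutive.
Qed.

Lemma Rabs_fresnel_le (th s : R) : 0 <= s -> Rabs (fresnel th s) <= s.
Proof.
intros hs.
assert (h := Rabs_increment_le (fresnel th) (fun u => u)
  (fun u => cos (u ^ 2 / 2 - th)) (fun _ => 1) 0 s hs).
rewrite fresnel_0, !Rminus_0_r in h; apply h.
- intros x _; apply is_derive_fresnel.
- intros x _; apply: is_derive_id.
- intros x _; apply Rabs_le, COS_bound.
Qed.

(** One integration by parts against [1 / u]: the primitive minus
    [sin (u ^ 2 / 2 - th) / u] has a derivative bounded by [1 / u ^ 2]. *)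
Lemma fresnel_tail (th s r : R) : 0 < s -> s <= r ->
  Rabs (fresnel th r - fresnel th s) <= 2 / s.
Proof.
intros hs hr.
assert (h := Rabs_increment_le
  (fun u => fresnel th u - sin (u ^ 2 / 2 - th) / u) (fun u => - / u)
  (fun u => sin (u ^ 2 / 2 - th) / u ^ 2) (fun u => 1 / u ^ 2) s r hr).
simpl in h.
assert (hb : forall u, 0 < u -> Rabs (sin (u ^ 2 / 2 - th) / u) <= / u).
{ intros u hu; unfold Rdiv; rewrite Rabs_mult, (Rabs_pos_eq (/ u)).
  - rewrite <- (Rmult_1_l (/ u)) at 2; apply Rmult_le_compat_r.
    + left; now apply Rinv_0_lt_compat.
    + apply Rabs_le, SIN_bound.
  - left; now apply Rinv_0_lt_compat. }
assert (h1 := hb s hs); assert (h2 := hb r ltac:(lra)).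
simpl in h1, h2.
lapply h; [clear h; intro h; lapply h; [clear h; intro h; lapply h;
  [clear h; intro h|]|]|].
- apply Rabs_le_between in h; apply Rabs_le_between in h1.
  apply Rabs_le_between in h2.
  apply Rabs_le; unfold Rdiv at 1 2; lra.
- intros u hu; unfold Rdiv; rewrite Rabs_mult, (Rabs_pos_eq (/ _)).
  + apply Rmult_le_compat_r.
    * left; apply Rinv_0_lt_compat; nra.
    * apply Rabs_le, SIN_bound.
  + left; apply Rinv_0_lt_compat; nra.
- intros u hu; auto_derive; [lra | field; lra].
- intros u hu.
  evar_last.
  { apply: is_derive_minus; [apply is_derive_fresnel |].
    auto_derive; [lra | reflexivity]. }
  unfold minus, plus, opp, Rminus, Rdiv; simpl; field; lra.
Qed.

(** The point is the uniformity in [th] as well as in [s]: the decay of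
    [phase_average] uses a phase that depends on [s]. *)
Lemma Rabs_fresnel_le_3 (th s : R) : 0 <= s -> Rabs (fresnel th s) <= 3.
Proof.
intros hs; destruct (Rle_or_lt s 1) as [h|h].
- assert (h0 := Rabs_fresnel_le th s hs); lra.
- assert (h1 := Rabs_fresnel_le th 1 ltac:(lra)).
  assert (h2 := fresnel_tail th 1 s ltac:(lra) ltac:(lra)).
  replace (fresnel th s) with (fresnel th s - fresnel th 1 + fresnel th 1)
    by ring.
  eapply Rle_trans; [apply Rabs_triang | lra].
Qed.

(** The improper integral over the positive half line, taken along the
    integers; [fresnel_limit_rate] shows that this subsequence suffices. *)
Definition fresnel_limit (th : R) : R :=
  real (Lim_seq (fun n => fresnel th (INR n))).

Lemma is_lim_seq_fresnel (th : R) :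
  is_lim_seq (fun n => fresnel th (INR n)) (fresnel_limit th).
Proof.
apply Lim_seq_correct', ex_lim_seq_cauchy_corr.
intros eps.
destruct (nfloor_ex (2 / eps)) as [N [_ hN]].
{ left; apply Rdiv_lt_0_compat; [lra | apply cond_pos]. }
exists (S N).
assert (key : forall n m, (S N <= n)%nat -> (n <= m)%nat ->
  Rabs (fresnel th (INR n) - fresnel th (INR m)) < eps).
{ intros n m hn hm.
  apply le_INR in hn; apply le_INR in hm; rewrite S_INR in hn.
  assert (heps := cond_pos eps).
  assert (hp : 0 < 2 / eps) by (apply Rdiv_lt_0_compat; lra).
  rewrite Rabs_minus_sym.
  eapply Rle_lt_trans; [apply fresnel_tail; lra |].
  assert (hn' : 2 / eps < INR n) by lra.
  apply (Rmult_lt_reg_r (INR n)); [lra |].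
  replace (2 / INR n * INR n) with (2 / eps * eps) by (field; lra).
  rewrite Rmult_comm; apply Rmult_lt_compat_l; lra. }
intros n m hn hm; destruct (Nat.le_ge_cases n m) as [h|h].
- now apply key.
- rewrite Rabs_minus_sym; now apply key.
Qed.

Lemma fresnel_limit_rate (th s : R) : 0 < s ->
  Rabs (fresnel th s - fresnel_limit th) <= 2 / s.
Proof.
intros hs.
assert (hl : is_lim_seq
  (fun n => Rabs (fresnel th s - fresnel th (INR n)))
  (Rabs (fresnel th s - fresnel_limit th))).
{ apply (is_lim_seq_abs _ (Finite _)), is_lim_seq_minus';
    [apply is_lim_seq_const | apply is_lim_seq_fresnel]. }
refine (is_lim_seq_le_loc _ (fun _ => 2 / s) _ (Finite (2 / s)) _ hl
  (is_lim_seq_const _)).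
destruct (nfloor_ex s) as [N [_ hN]]; [lra |].
exists (S N); intros n hn; apply le_INR in hn; rewrite S_INR in hn.
rewrite Rabs_minus_sym; apply fresnel_tail; lra.
Qed.

(** * The value of the complete Fresnel integrals *)

Lemma cos_sub_quarter (a b : R) : cos (a - (b + PI / 2)) = sin (a - b).
Proof.
rewrite <- cos_shift, <- cos_neg; f_equal; ring.
Qed.

(** The imaginary part of [exp (- i sg) G s], where [G s] is the integral of
    [exp (i s ^ 2 (1 + v ^ 2) / 2) / (1 + v ^ 2)] over [[0, 1]]. *)
Definition phase_average (sg s : R) : R :=
  RInt (fun v => sin (s ^ 2 * (1 + v ^ 2) / 2 - sg) / (1 + v ^ 2)) 0 1.

Lemma one_plus_sqr_pos (v : R) : 0 < 1 + v ^ 2.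
Proof. nra. Qed.

Lemma is_RInt_phase_average (sg s : R) :
  is_RInt (fun v => sin (s ^ 2 * (1 + v ^ 2) / 2 - sg) / (1 + v ^ 2)) 0 1
    (phase_average sg s).
Proof.
apply: RInt_correct; apply: ex_RInt_continuous => v _.
apply continuous_of_ex_derive; auto_derive.
assert (h := one_plus_sqr_pos v); simpl in h; lra.
Qed.

Lemma is_derive_phase_average (sg s : R) :
  is_derive (phase_average sg) s
    (RInt (fun v => s * cos (s ^ 2 * (1 + v ^ 2) / 2 - sg)) 0 1).
Proof.
assert (hd : forall z v, is_derive
  (fun z => sin (z ^ 2 * (1 + v ^ 2) / 2 - sg) / (1 + v ^ 2)) z
  (z * cos (z ^ 2 * (1 + v ^ 2) / 2 - sg))).
{ intros z v; assert (h := one_plus_sqr_pos v).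
  auto_derive; [simpl in h; lra|].
  simpl in *; unfold Rminus, Rdiv; field; lra. }
assert (e : RInt (fun v => s * cos (s ^ 2 * (1 + v ^ 2) / 2 - sg)) 0 1 =
  RInt (fun v => Derive
    (fun z => sin (z ^ 2 * (1 + v ^ 2) / 2 - sg) / (1 + v ^ 2)) s) 0 1).
{ apply RInt_ext; intros v _; symmetry; apply is_derive_unique, hd. }
rewrite e; apply (is_derive_RInt_param
  (fun s v => sin (s ^ 2 * (1 + v ^ 2) / 2 - sg) / (1 + v ^ 2))).
- apply filter_forall; intros z v _; eexists; apply hd.
- intros v _; eapply continuity_2d_pt_ext.
  { intros z w; symmetry; apply is_derive_unique, hd. }
  apply continuity_2d_pt_mult; [apply continuity_2d_pt_id1 |].
  apply (continuity_1d_2d_pt_comp cos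
    (fun z w => z ^ 2 * (1 + w ^ 2) / 2 - sg)); [apply continuity_cos |].
  apply continuity_2d_pt_minus; [| apply continuity_2d_pt_const].
  apply continuity_2d_pt_mult; [| apply continuity_2d_pt_const].
  apply continuity_2d_pt_mult.
  + apply (continuity_1d_2d_pt_comp (fun z => z ^ 2) (fun z _ => z));
      [| apply continuity_2d_pt_id1].
    apply derivable_continuous_pt, derivable_pt_pow.
  + apply continuity_2d_pt_plus; [apply continuity_2d_pt_const |].
    apply (continuity_1d_2d_pt_comp (fun z => z ^ 2) (fun _ z => z));
      [| apply continuity_2d_pt_id2].
    apply derivable_continuous_pt, derivable_pt_pow.
- apply filter_forall; intros z; eexists; apply is_RInt_phase_average.
Qed.

(** The left side is the integral over [[0, s]] of
    [cos ((s ^ 2 + u ^ 2) / 2 - (al + be))] by the addition formula; then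
    [u = s v]. It is half of the derivative in the next lemma. *)
Lemma fresnel_rotate (al be s : R) :
  cos (s ^ 2 / 2 - al) * fresnel be s
  - cos (s ^ 2 / 2 - (al + PI / 2)) * fresnel (be + PI / 2) s =
  RInt (fun v => s * cos (s ^ 2 * (1 + v ^ 2) / 2 - (al + be))) 0 1.
Proof.
symmetry; apply is_RInt_unique.
assert (h := is_RInt_minus _ _ _ _ _ _
  (is_RInt_scal _ _ _ (cos (s ^ 2 / 2 - al)) _ (is_RInt_fresnel be s))
  (is_RInt_scal _ _ _ (cos (s ^ 2 / 2 - (al + PI / 2))) _
    (is_RInt_fresnel (be + PI / 2) s))).
assert (h' : is_RInt (fun u => cos (s ^ 2 / 2 + u ^ 2 / 2 - (al + be)))
  (s * 0 + 0) (s * 1 + 0) (cos (s ^ 2 / 2 - al) * fresnel be s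
  - cos (s ^ 2 / 2 - (al + PI / 2)) * fresnel (be + PI / 2) s)).
{ assert (e0 : s * 0 + 0 = 0) by ring.
  assert (e1 : s * 1 + 0 = s) by ring.
  rewrite e0, e1; eapply is_RInt_ext; [|exact h].
  intros u _; rewrite !cos_sub_quarter.
  assert (e : s ^ 2 / 2 + u ^ 2 / 2 - (al + be)
    = (s ^ 2 / 2 - al) + (u ^ 2 / 2 - be)) by ring.
  rewrite e, cos_plus; reflexivity. }
apply is_RInt_comp_lin in h'.
eapply is_RInt_ext; [|exact h'].
intros v _; unfold scal; simpl; unfold mult; simpl.
do 2 f_equal; field.
Qed.

(** The real part of [exp (- i (al + be)) (F s ^ 2 + 2 i (G s - G 0)) = 0]. Both
    sides have the same derivative by [fresnel_rotate], used once for each order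
    of [al] and [be], and at [0] the arctangent gives [G 0 = pi / 4]. *)
Lemma fresnel_product_phase_average (al be s : R) : 0 < s ->
  fresnel al s * fresnel be s - fresnel (al + PI / 2) s * fresnel (be + PI / 2) s
  = 2 * phase_average (al + be) s + PI / 2 * sin (al + be).
Proof.
intros hs.
assert (e0 : phase_average (al + be) 0 = - (PI / 4) * sin (al + be)).
{ apply is_RInt_unique.
  assert (h : is_RInt (fun v => - sin (al + be) * / (1 + v ^ 2)) 0 1
    (minus (- sin (al + be) * atan 1) (- sin (al + be) * atan 0))).
  { apply (is_RInt_derive (fun v => - sin (al + be) * atan v)).
    - intros v _; assert (h := one_plus_sqr_pos v).
      auto_derive; [trivial | unfold Rsqr; simpl in *; field; lra].
    - intros v _; apply continuous_of_ex_derive; auto_derive.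
      assert (h := one_plus_sqr_pos v); simpl in h; lra. }
  rewrite atan_1, atan_0 in h; unfold minus, plus, opp in h; simpl in h.
  replace (- (PI / 4) * sin (al + be))
    with (- sin (al + be) * (PI / 4) + - (- sin (al + be) * 0)) by ring.
  eapply is_RInt_ext; [|exact h].
  intros v _; simpl.
  replace (0 * (0 * 1) * _ / 2 - (al + be)) with (- (al + be)) by field.
  rewrite sin_neg; reflexivity. }
assert (h := eq_is_derive (fun s => fresnel al s * fresnel be s
  - fresnel (al + PI / 2) s * fresnel (be + PI / 2) s
  - 2 * phase_average (al + be) s) 0 s).
simpl in h; rewrite !fresnel_0, e0 in h.
enough (0 * 0 - 0 * 0 - 2 * (- (PI / 4) * sin (al + be)) =
  fresnel al s * fresnel be s
  - fresnel (al + PI / 2) s * fresnel (be + PI / 2) s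
  - 2 * phase_average (al + be) s) by lra.
apply h; [| exact hs]; clear; intros t _.
assert (h1 := fresnel_rotate al be t); assert (h2 := fresnel_rotate be al t).
rewrite (Rplus_comm be al) in h2.
assert (d := is_derive_fresnel).
evar_last.
{ apply: is_derive_minus; [apply: is_derive_minus |].
  - apply: is_derive_mult; [apply d | apply d | intros; apply Rmult_comm].
  - apply: is_derive_mult; [apply d | apply d | intros; apply Rmult_comm].
  - apply: is_derive_scal; apply is_derive_phase_average. }
unfold minus, plus, opp, mult, scal, zero; simpl.
unfold mult; simpl.
simpl in *; lra.
Qed.

(** Decay at infinity: for fixed [s], the oscillating factor is the derivative
    in [v] of [fresnel ta (s v) / s], which is [O(1 / s)], and [1 / (1 + v ^ 2)]
    is smooth, so one integration by parts in [v] suffices. *)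
Lemma Rabs_phase_average_le (sg s : R) : 0 < s ->
  Rabs (phase_average sg s) <= 9 / s.
Proof.
intros hs.
(* [sin (s ^ 2 (1 + v ^ 2) / 2 - sg) = cos ((s v) ^ 2 / 2 - ta)] *)
pose (ta := PI / 2 + sg - s ^ 2 / 2).
pose (E := fun v => fresnel ta (s * v) / (s * (1 + v ^ 2))).
pose (r := fun v => 2 * v * fresnel ta (s * v) / (s * (1 + v ^ 2) ^ 2)).
assert (hc : forall v, ex_derive r v).
{ intros v; assert (h := one_plus_sqr_pos v); unfold r; auto_derive.
  split; [eexists; apply is_derive_fresnel | split; [|trivial]].
  simpl in h; apply Rmult_integral_contrapositive_currified; [lra |].
  apply Rmult_integral_contrapositive_currified; lra. }
assert (hr : is_RInt r 0 1 (RInt r 0 1)).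
{ apply: RInt_correct; apply: ex_RInt_continuous => v _.
  now apply continuous_of_ex_derive. }
assert (hE : is_RInt (fun v =>
  sin (s ^ 2 * (1 + v ^ 2) / 2 - sg) / (1 + v ^ 2) - r v) 0 1
  (minus (E 1) (E 0))).
{ apply: (is_RInt_derive E).
  - intros v _; assert (h := one_plus_sqr_pos v); unfold E, r; auto_derive.
    + split; [eexists; apply is_derive_fresnel | split; [|trivial]].
      simpl in h; apply Rmult_integral_contrapositive_currified; lra.
    + assert (e : Derive (fun x : R => fresnel ta x) (s * v)
        = cos ((s * v) ^ 2 / 2 - ta))
        by (apply is_derive_unique, is_derive_fresnel).
      rewrite e.
      rewrite <- cos_sub_quarter.
      replace ((s * v) ^ 2 / 2 - ta)
        with (s ^ 2 * (1 + v ^ 2) / 2 - (sg + PI / 2)) by (unfold ta; field).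
      simpl in *; field; lra.
  - intros v _; assert (h := one_plus_sqr_pos v).
    apply: continuous_minus; apply continuous_of_ex_derive; [|apply hc].
    auto_derive; simpl in h; lra. }
assert (e : phase_average sg s = E 1 - E 0 + RInt r 0 1).
{ apply is_RInt_unique.
  eapply is_RInt_ext; [|exact (is_RInt_plus _ _ _ _ _ _ hE hr)].
  intros v _; unfold plus; simpl; ring. }
assert (hP : forall v, 0 <= v -> Rabs (fresnel ta (s * v)) <= 3).
{ intros v hv; apply Rabs_fresnel_le_3; apply Rmult_le_pos; lra. }
assert (hi := Rinv_0_lt_compat s hs).
assert (b1 : Rabs (E 1) <= 3 / s).
{ unfold E, Rdiv; rewrite Rabs_mult; apply Rmult_le_compat;
    try apply Rabs_pos; [apply hP; lra |].
  rewrite Rabs_pos_eq.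
  - apply Rinv_le_contravar; lra.
  - left; apply Rinv_0_lt_compat; lra. }
assert (b0 : E 0 = 0).
{ unfold E; rewrite Rmult_0_r, fresnel_0; unfold Rdiv; ring. }
assert (b2 : Rabs (RInt r 0 1) <= (1 - 0) * (2 * (3 / s))).
{ apply abs_RInt_le_const; [lra | eexists; exact hr |].
  intros v hv; unfold r.
  replace (2 * v * fresnel ta (s * v) / (s * (1 + v ^ 2) ^ 2)) with
    (2 * v * (fresnel ta (s * v) * / (s * (1 + v ^ 2) ^ 2)))
    by (unfold Rdiv; ring).
  rewrite Rabs_mult; apply Rmult_le_compat; try apply Rabs_pos.
  - rewrite Rabs_pos_eq; lra.
  - unfold Rdiv; rewrite Rabs_mult; apply Rmult_le_compat;
      try apply Rabs_pos; [apply hP; lra |].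
    assert (1 <= (1 + v ^ 2) ^ 2) by nra.
    rewrite Rabs_pos_eq.
    + apply Rinv_le_contravar; nra.
    + left; apply Rinv_0_lt_compat; nra. }
rewrite e, b0; eapply Rle_trans; [apply Rabs_triang |].
rewrite Rminus_0_r; unfold Rdiv in *; lra.
Qed.

(** The limit of [fresnel_product_phase_average]: the square of the complete
    integral of [exp (i u ^ 2 / 2)] is [i pi / 2], in real form. *)
Lemma fresnel_limit_product (al be : R) :
  fresnel_limit al * fresnel_limit be
  - fresnel_limit (al + PI / 2) * fresnel_limit (be + PI / 2)
  = PI / 2 * sin (al + be).
Proof.
assert (hN : is_lim_seq (fun n => phase_average (al + be) (INR n)) 0).
{ apply is_lim_seq_abs_0.
  assert (h9 : is_lim_seq (fun n => 9 / INR n) 0).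
  { apply (is_lim_seq_div _ _ (Finite 9) p_infty);
      [apply is_lim_seq_const | apply is_lim_seq_INR | discriminate |].
    assert (e : Finite 0 = Finite (9 * 0)) by (f_equal; ring).
    rewrite e; exact eq_refl. }
  refine (is_lim_seq_le_le_loc (fun _ => 0) _ _ _ _ (is_lim_seq_const 0) h9).
  exists 1%nat; intros n hn; split; [apply Rabs_pos |].
  apply Rabs_phase_average_le, lt_0_INR; lia. }
assert (hJ := fun th => is_lim_seq_fresnel th).
assert (h1 := is_lim_seq_minus' _ _ _ _
  (is_lim_seq_mult' _ _ _ _ (hJ al) (hJ be))
  (is_lim_seq_mult' _ _ _ _ (hJ (al + PI / 2)) (hJ (be + PI / 2)))).
assert (h2 := is_lim_seq_plus' _ _ _ _
  (is_lim_seq_mult' _ _ _ _ (is_lim_seq_const 2) hN)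
  (is_lim_seq_const (PI / 2 * sin (al + be)))).
apply (is_lim_seq_ext_loc _ (fun n => fresnel al (INR n) * fresnel be (INR n)
  - fresnel (al + PI / 2) (INR n) * fresnel (be + PI / 2) (INR n))) in h2.
- apply is_lim_seq_unique in h1; apply is_lim_seq_unique in h2.
  rewrite h1 in h2; injection h2; lra.
- exists 1%nat; intros n hn; symmetry.
  apply fresnel_product_phase_average, lt_0_INR; lia.
Qed.

Lemma fresnel_limit_shift_PI (th : R) :
  fresnel_limit (th + PI) = - fresnel_limit th.
Proof.
assert (h1 := is_lim_seq_fresnel (th + PI)).
assert (h2 := proj1 (is_lim_seq_opp _ _) (is_lim_seq_fresnel th)).
apply (is_lim_seq_ext _ _ _ (fun n => eq_sym (fresnel_shift_PI th (INR n))))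
  in h2.
apply is_lim_seq_unique in h1; apply is_lim_seq_unique in h2.
rewrite h1 in h2; now injection h2.
Qed.

(** [fresnel_limit_product] only determines this number up to sign. Bounding
    [cos z] below by [1 - z ^ 2 / 2] gives [fresnel (pi/4) 2 > 1], while the tail
    beyond [2] is at most [1]. *)
Lemma fresnel_limit_PI4_pos : 0 < fresnel_limit (PI / 4).
Proof.
assert (h1 := fresnel_limit_rate (PI / 4) 2 ltac:(lra)).
(* The first function is the primitive of [1 - (u ^ 2 / 2 - PI / 4) ^ 2 / 2]. *)
assert (h2 := increment_le_increment
  (fun u => (1 - PI ^ 2 / 32) * u + PI / 24 * u ^ 3 - u ^ 5 / 40)
  (fresnel (PI / 4)) (fun u => 1 - (u ^ 2 / 2 - PI / 4) ^ 2 / 2)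
  (fun u => cos (u ^ 2 / 2 - PI / 4)) 0 2 ltac:(lra)).
simpl in h2; rewrite fresnel_0 in h2.
assert (hp : 3 < PI) by (assert (h := PI2_3_2); lra).
assert (hp' := PI_4).
apply Rabs_le_between in h1.
enough (1 < fresnel (PI / 4) 2) by lra.
eapply Rlt_le_trans; [| rewrite <- (Rminus_0_r (fresnel _ _)); apply h2].
- nra.
- intros u _; auto_derive; [trivial | field].
- intros u _; apply is_derive_fresnel.
- intros u _.
  set (z := u * (u * 1) / 2 - PI / 4).
  assert (e : z = 2 * (z / 2)) by field.
  rewrite e at 3; rewrite cos_2a_sin.
  assert (h := bounded_variation sin cos 1 0 (z / 2)).
  lapply h; [clear h; intro h |].
  + rewrite sin_0, Rmult_1_l, !Rminus_0_r in h.
    apply Rsqr_le_abs_1 in h; unfold Rsqr in h; lra.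
  + intros x _; split; [apply is_derive_sin | apply Rabs_le, COS_bound].
Qed.

(** With phases [pi/4] and [3 pi/4] the product formula reads
    [2 L(pi/4) L(3 pi/4) = 0]. *)
Lemma fresnel_limit_3PI4 : fresnel_limit (PI / 4 + PI / 2) = 0.
Proof.
assert (h := fresnel_limit_product (PI / 4) (PI / 4 + PI / 2)).
replace (PI / 4 + (PI / 4 + PI / 2)) with PI in h by field.
replace (PI / 4 + PI / 2 + PI / 2) with (PI / 4 + PI) in h by field.
rewrite sin_PI, fresnel_limit_shift_PI in h.
assert (hp := fresnel_limit_PI4_pos); nra.
Qed.

Lemma fresnel_limit_PI4 : fresnel_limit (PI / 4) = sqrt (2 * PI) / 2.
Proof.
assert (h := fresnel_limit_product (PI / 4) (PI / 4)).
rewrite fresnel_limit_3PI4 in h.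
replace (PI / 4 + PI / 4) with (PI / 2) in h by field.
rewrite sin_PI2 in h.
assert (hp := fresnel_limit_PI4_pos).
assert (e : 2 * PI = (2 * fresnel_limit (PI / 4)) ^ 2) by (simpl; lra).
rewrite e, sqrt_pow2; lra.
Qed.

(** * Stationary phase *)

(** The second primitive of [cos (s ^ 2 / 2 - th)], normalised so that
    [s * fresnel th s] is the only term that can grow. *)
Definition fresnel_primitive (th s : R) : R :=
  s * fresnel th s - sin (s ^ 2 / 2 - th).

Lemma is_derive_fresnel_primitive (th s : R) :
  is_derive (fresnel_primitive th) s (fresnel th s).
Proof.
unfold fresnel_primitive; auto_derive.
- eexists; apply is_derive_fresnel.
- assert (e : Derive (fun x : R => fresnel th x) s = cos (s ^ 2 / 2 - th))
    by (apply is_derive_unique, is_derive_fresnel).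
  rewrite e; simpl; unfold Rminus, Rdiv; field.
Qed.

(** [s * fresnel th s] is even, and for positive [s] it differs from
    [s * fresnel_limit th] by at most [s * (2 / s)]. *)
Lemma fresnel_primitive_asymptote (th s : R) :
  Rabs (fresnel_primitive th s - fresnel_limit th * Rabs s) <= 3.
Proof.
assert (key : forall s, 0 < s ->
  Rabs (s * fresnel th s - s * fresnel_limit th) <= 2).
{ clear s; intros s hs.
  rewrite <- Rmult_minus_distr_l, Rabs_mult, (Rabs_pos_eq s) by lra.
  replace 2 with (s * (2 / s)) by (field; lra).
  apply Rmult_le_compat_l; [lra |]; now apply fresnel_limit_rate. }
assert (hb : Rabs (s * fresnel th s - fresnel_limit th * Rabs s) <= 2).
{ destruct (Rtotal_order s 0) as [h|[h|h]].
  - rewrite (Rabs_left s) by lra.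
    assert (k := key (- s) ltac:(lra)); rewrite fresnel_opp in k.
    replace (s * fresnel th s - fresnel_limit th * - s)
      with (- s * - fresnel th s - - s * fresnel_limit th) by ring; exact k.
  - subst; rewrite Rabs_R0, Rmult_0_l, Rmult_0_r, Rminus_0_r, Rabs_R0; lra.
  - rewrite (Rabs_pos_eq s) by lra.
    rewrite (Rmult_comm (fresnel_limit th)); now apply key. }
assert (hs : Rabs (sin (s ^ 2 / 2 - th)) <= 1) by apply Rabs_le, SIN_bound.
unfold fresnel_primitive; apply Rabs_le_between in hb.
apply Rabs_le_between in hs; apply Rabs_le; lra.
Qed.

Definition C2_vanishing_at_ends (f f1 f2 : R -> R) (A B : R) : Prop :=
  (forall x, is_derive f x (f1 x)) /\ (forall x, is_derive f1 x (f2 x)) /\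
  (forall x, continuous f2 x) /\ f A = 0 /\ f1 A = 0 /\ f B = 0 /\ f1 B = 0.

Lemma continuous_of_is_derive (f df : R -> R) :
  (forall x, is_derive f x (df x)) -> forall x, continuous f x.
Proof. intros h x; apply continuous_of_ex_derive; eexists; apply h. Qed.

Lemma ex_RInt_of_continuous (f : R -> R) (a b : R) :
  (forall x, continuous f x) -> ex_RInt f a b.
Proof. intros h; apply: ex_RInt_continuous; auto. Qed.

Lemma green_identity (W W1 W2 f f1 f2 : R -> R) (A B : R) :
  (forall x, is_derive W x (W1 x)) -> (forall x, is_derive W1 x (W2 x)) ->
  (forall x, continuous W2 x) -> C2_vanishing_at_ends f f1 f2 A B ->
  RInt (fun x => W2 x * f x) A B = RInt (fun x => W x * f2 x) A B.
Proof.
intros hW hW1 cW2 [hf [hf1 [cf2 [fA [f1A [fB f1B]]]]]].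
assert (cW := continuous_of_is_derive _ _ hW).
assert (cf := continuous_of_is_derive _ _ hf).
assert (h : is_RInt (fun x => W2 x * f x - W x * f2 x) A B
  (minus (W1 B * f B - W B * f1 B) (W1 A * f A - W A * f1 A))).
{ apply (is_RInt_derive (fun x => W1 x * f x - W x * f1 x)).
  - intros x _; evar_last.
    { apply: is_derive_minus.
      - apply: is_derive_mult; [apply hW1 | apply hf | apply Rmult_comm].
      - apply: is_derive_mult; [apply hW | apply hf1 | apply Rmult_comm]. }
    unfold minus, plus, opp, mult; simpl; ring.
  - intros x _; apply: continuous_minus; apply: continuous_mult; auto. }
rewrite fA, f1A, fB, f1B in h.
apply (is_RInt_unique (V := R_CompleteNormedModule)) in h.
rewrite (RInt_minus (V := R_CompleteNormedModule)
  (fun x => W2 x * f x) (fun x => W x * f2 x)) in h.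
- unfold minus, plus, opp in h; simpl in h; lra.
- apply ex_RInt_of_continuous; intros x; apply: continuous_mult; auto.
- apply ex_RInt_of_continuous; intros x; apply: continuous_mult; auto.
Qed.

(** The second derivative of [|x - c|] is twice the point mass at [c]; integrate
    by parts on each side of [c]. *)
Lemma is_RInt_Rabs_second_derivative (f f1 f2 : R -> R) (A B c : R) :
  C2_vanishing_at_ends f f1 f2 A B -> A <= c <= B ->
  is_RInt (fun x => Rabs (x - c) * f2 x) A B (2 * f c).
Proof.
intros [hf [hf1 [cf2 [fA [f1A [fB f1B]]]]]] hc.
assert (h : forall a b, is_RInt (fun x => (x - c) * f2 x) a b
  (minus ((b - c) * f1 b - f b) ((a - c) * f1 a - f a))).
{ intros a b; apply (is_RInt_derive (fun x => (x - c) * f1 x - f x)).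
  - intros x _; evar_last.
    { apply: is_derive_minus; [apply: is_derive_mult;
        [ | apply hf1 | apply Rmult_comm] | apply hf].
      apply: is_derive_minus; [apply is_derive_id | apply is_derive_const]. }
    unfold minus, plus, opp, mult, one, zero; simpl; ring.
  - intros x _; apply: continuous_mult; [| auto].
    apply continuous_of_ex_derive; auto_derive; trivial. }
replace (2 * f c) with (plus
  (opp (minus ((c - c) * f1 c - f c) ((A - c) * f1 A - f A)))
  (minus ((B - c) * f1 B - f B) ((c - c) * f1 c - f c))).
2: { rewrite fA, f1A, fB, f1B; unfold minus, plus, opp; simpl; ring. }
apply: (is_RInt_Chasles (V := R_NormedModule) _ A c B).
- eapply is_RInt_ext; [|exact (is_RInt_opp _ _ _ _ (h A c))].
  rewrite Rmin_left, Rmax_right by lra; intros x hx.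
  rewrite Rabs_left by lra; unfold opp; simpl; ring.
- eapply is_RInt_ext; [|exact (h c B)].
  rewrite Rmin_left, Rmax_right by lra; intros x hx.
  rewrite Rabs_pos_eq by lra; reflexivity.
Qed.

Definition kernel (th t z : R) : R :=
  1 / sqrt (2 * PI * t) * cos (z ^ 2 / (2 * t) - th).

Lemma sqrt_2PI_pos : 0 < sqrt (2 * PI).
Proof. apply sqrt_lt_R0; assert (h := PI_RGT_0); lra. Qed.

(** Stationary phase with rate [sqrt t], which comes from the scaling of the
    bounded error in [fresnel_primitive_asymptote]. *)
Lemma kernel_pairing_estimate (th : R) (f f1 f2 : R -> R) (A B c : R) :
  C2_vanishing_at_ends f f1 f2 A B -> A <= c <= B ->
  exists M, forall t, 0 < t ->
  Rabs (RInt (fun x => kernel th t (x - c) * f x) A B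
    - 2 * fresnel_limit th / sqrt (2 * PI) * f c) <= M * sqrt t.
Proof.
intros hf hc.
assert (hI := is_RInt_Rabs_second_derivative _ _ _ _ _ _ hf hc).
assert (hf0 := hf); destruct hf0 as [_ [_ [cf2 _]]].
assert (hk := sqrt_2PI_pos).
exists (3 / sqrt (2 * PI) * RInt (fun x => Rabs (f2 x)) A B).
intros t ht; assert (hst := sqrt_lt_R0 t ht).
assert (est : sqrt t * sqrt t = t) by (apply sqrt_sqrt; lra).
(* A second primitive of the kernel in [x]. *)
set (W := fun x => sqrt t * fresnel_primitive th ((x - c) / sqrt t)
  / sqrt (2 * PI)).
set (W1 := fun x => fresnel th ((x - c) / sqrt t) / sqrt (2 * PI)).
assert (hW : forall x, is_derive W x (W1 x)).
{ intros x; unfold W, W1; auto_derive.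
  - eexists; apply is_derive_fresnel_primitive.
  - assert (e : Derive (fun x : R => fresnel_primitive th x) ((x - c) / sqrt t)
      = fresnel th ((x - c) / sqrt t))
      by (apply is_derive_unique, is_derive_fresnel_primitive).
    unfold Rminus, Rdiv in *; rewrite e; field; lra. }
assert (hW1 : forall x, is_derive W1 x (kernel th t (x - c))).
{ intros x; unfold kernel, W1; auto_derive.
  - eexists; apply is_derive_fresnel.
  - assert (e : Derive (fun x : R => fresnel th x) ((x - c) / sqrt t)
      = cos (((x - c) / sqrt t) ^ 2 / 2 - th))
      by (apply is_derive_unique, is_derive_fresnel).
    unfold Rminus, Rdiv in e |- *; rewrite e.
    rewrite (sqrt_mult (2 * PI) t) by (assert (h := PI_RGT_0); lra).
    replace (((x + - c) * / sqrt t) ^ 2 * / 2 + - th)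
      with ((x + - c) ^ 2 * / (2 * t) + - th).
    + field; lra.
    + rewrite <- est at 1; field; lra. }
rewrite (green_identity W W1 _ f f1 f2 A B hW hW1); [| | exact hf].
2: { intros x; apply continuous_of_ex_derive; unfold kernel; auto_derive; lra. }
assert (cW := continuous_of_is_derive _ _ hW).
assert (hWI : is_RInt (fun x => W x * f2 x) A B
  (RInt (fun x => W x * f2 x) A B)).
{ apply: RInt_correct; apply ex_RInt_of_continuous.
  intros x; apply: continuous_mult; auto. }
assert (hA : is_RInt (fun x => Rabs (f2 x)) A B
  (RInt (fun x => Rabs (f2 x)) A B)).
{ apply: RInt_correct; apply ex_RInt_of_continuous.
  intros x; apply continuous_Rabs_comp; auto. }
set (k := fresnel_limit th / sqrt (2 * PI)).
assert (h : norm (minus (RInt (fun x => W x * f2 x) A B) (scal k (2 * f c)))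
  <= scal (3 * sqrt t / sqrt (2 * PI)) (RInt (fun x => Rabs (f2 x)) A B)).
{ refine (norm_RInt_le
    (fun x => minus (W x * f2 x) (scal k (Rabs (x - c) * f2 x)))
    (fun x => scal (3 * sqrt t / sqrt (2 * PI)) (Rabs (f2 x))) A B _ _ _ _
    (is_RInt_minus _ _ _ _ _ _ hWI (is_RInt_scal _ _ _ k _ hI))
    (is_RInt_scal _ _ _ _ _ hA)); [lra |].
  intros x _.
  change (Rabs (W x * f2 x - k * (Rabs (x - c) * f2 x))
    <= 3 * sqrt t / sqrt (2 * PI) * Rabs (f2 x)).
  replace (W x * f2 x - k * (Rabs (x - c) * f2 x))
    with ((W x - k * Rabs (x - c)) * f2 x) by ring.
  rewrite Rabs_mult; apply Rmult_le_compat_r; [apply Rabs_pos |].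
  set (z := (x - c) / sqrt t).
  assert (e : W x - k * Rabs (x - c) = sqrt t / sqrt (2 * PI)
    * (fresnel_primitive th z - fresnel_limit th * Rabs z)).
  { unfold z at 2; unfold W, k, Rdiv; rewrite Rabs_mult, Rabs_inv.
    rewrite (Rabs_pos_eq (sqrt t)) by lra; fold (Rdiv (x - c) (sqrt t)); fold z.
    field; lra. }
  rewrite e, Rabs_mult, (Rabs_pos_eq (sqrt t / _)).
  - replace (3 * sqrt t / sqrt (2 * PI)) with (sqrt t / sqrt (2 * PI) * 3)
      by (field; lra).
    apply Rmult_le_compat_l; [| apply fresnel_primitive_asymptote].
    apply Rdiv_le_0_compat; lra.
  - apply Rdiv_le_0_compat; lra. }
unfold k, norm, minus, plus, opp, scal in h; simpl in h.
unfold mult, abs in h; simpl in h.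
eapply Rle_trans; [| eapply Rle_trans; [exact h |]]; right.
- f_equal; field; lra.
- field; lra.
Qed.

Lemma filterlim_of_sqrt_estimate (g : R -> R) (l M : R) :
  (forall t, 0 < t -> Rabs (g t - l) <= M * sqrt t) ->
  filterlim g (at_right 0) (locally l).
Proof.
intros hg; apply filterlim_locally; intros eps.
assert (heps := cond_pos eps); assert (hM := Rabs_pos M).
set (d := eps / (Rabs M + 1)).
assert (hd : 0 < d) by (apply Rdiv_lt_0_compat; lra).
assert (hd2 : 0 < d ^ 2) by (apply pow_lt; lra).
exists (mkposreal _ hd2); intros t ht h0.
change (Rabs (t - 0) < d ^ 2) in ht; rewrite Rminus_0_r, Rabs_pos_eq in ht by lra.
change (Rabs (g t - l) < eps).
assert (hs : sqrt t < d).
{ rewrite <- (sqrt_pow2 d) by lra; apply sqrt_lt_1; lra. }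
assert (hs0 := sqrt_pos t).
eapply Rle_lt_trans; [apply hg; exact h0 |].
assert (h1 : M * sqrt t <= (Rabs M + 1) * sqrt t).
{ apply Rmult_le_compat_r; [lra |]; assert (h := Rle_abs M); lra. }
assert (h2 : (Rabs M + 1) * sqrt t < (Rabs M + 1) * d)
  by (apply Rmult_lt_compat_l; lra).
assert (e : (Rabs M + 1) * d = eps) by (unfold d; field; lra).
lra.
Qed.

(** * The reflected kernel *)

Definition reflected (y : R) (k : R -> R) (x : R) : R := k (x - y) - k (x + y).

Lemma is_derive_reflected (y : R) (k dk : R -> R) (x : R) :
  (forall z, is_derive k z (dk z)) ->
  is_derive (reflected y k) x (reflected y dk x).
Proof.
intros hk; unfold reflected; auto_derive.
- repeat split; eexists; apply hk.
- assert (e : forall z, Derive (fun x : R => k x) z = dk z)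
    by (intros z; apply is_derive_unique, hk).
  rewrite !e; unfold Rminus; ring.
Qed.

Lemma ex_derive_kernel (th t z : R) : 0 < t -> ex_derive (kernel th t) z.
Proof. intros ht; unfold kernel; auto_derive; lra. Qed.

(** The left end of the interval is the mirror point [- y], so that both
    centres of the reflected kernel lie in the interval; [f] vanishes at
    [- y], which removes the image term from the limit. *)
Lemma reflected_kernel_limit (y th : R) (f f1 f2 : R -> R) (B : R) : 0 <= y ->
  y <= B -> C2_vanishing_at_ends f f1 f2 (- y) B ->
  filterlim (fun t => RInt (fun x => reflected y (kernel th t) x * f x) (- y) B)
    (at_right 0) (locally (2 * fresnel_limit th / sqrt (2 * PI) * f y)).
Proof.
intros hy hB hf.
destruct (kernel_pairing_estimate th f f1 f2 (- y) B y hf ltac:(lra))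
  as [M1 h1].
destruct (kernel_pairing_estimate th f f1 f2 (- y) B (- y) hf ltac:(lra))
  as [M2 h2].
destruct hf as [hf [_ [_ [fA _]]]].
apply (filterlim_of_sqrt_estimate _ _ (M1 + M2)); intros t ht.
specialize (h1 t ht); specialize (h2 t ht).
rewrite fA, Rmult_0_r, Rminus_0_r in h2.
assert (c : forall c, ex_RInt (fun x => kernel th t (x - c) * f x) (- y) B).
{ intros c; apply ex_RInt_of_continuous; intros x.
  apply continuous_of_ex_derive; auto_derive.
  split; [now apply ex_derive_kernel | split; [eexists; apply hf | trivial]]. }
rewrite (RInt_ext _ (fun x => kernel th t (x - y) * f x
  - kernel th t (x - - y) * f x)).
2: { intros x _; unfold reflected; simpl.
     replace (x - - y) with (x + y) by ring; ring. }
rewrite (RInt_minus (V := R_CompleteNormedModule)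
  (fun x => kernel th t (x - y) * f x)) by apply c.
unfold minus, plus, opp; simpl.
apply Rabs_le_between in h1; apply Rabs_le_between in h2; apply Rabs_le; lra.
Qed.

Definition kernel_x (th t z : R) : R :=
  1 / sqrt (2 * PI * t) * (- (z / t) * sin (z ^ 2 / (2 * t) - th)).

Definition kernel_xx (th t z : R) : R :=
  1 / sqrt (2 * PI * t) * (- (z ^ 2 / t ^ 2) * cos (z ^ 2 / (2 * t) - th)
    - 1 / t * sin (z ^ 2 / (2 * t) - th)).

Definition kernel_xxx (th t z : R) : R :=
  1 / sqrt (2 * PI * t) * (- (3 * z / t ^ 2) * cos (z ^ 2 / (2 * t) - th)
    + z ^ 3 / t ^ 3 * sin (z ^ 2 / (2 * t) - th)).

Definition kernel_xxxx (th t z : R) : R :=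
  1 / sqrt (2 * PI * t) *
  ((z ^ 4 / t ^ 4 - 3 / t ^ 2) * cos (z ^ 2 / (2 * t) - th)
    + 6 * z ^ 2 / t ^ 3 * sin (z ^ 2 / (2 * t) - th)).

Lemma sqrt_2PI_mul_pos (t : R) : 0 < t -> 0 < sqrt (2 * PI * t).
Proof.
intros ht; apply sqrt_lt_R0; assert (h := PI_RGT_0); nra.
Qed.

Ltac derive_kernel ht :=
  assert (hs := sqrt_2PI_mul_pos _ ht);
  unfold kernel, kernel_x, kernel_xx, kernel_xxx, kernel_xxxx; auto_derive;
  [repeat split; try lra; simpl;
   repeat apply Rmult_integral_contrapositive_currified; lra |];
  simpl in *; unfold Rminus, Rdiv; field; lra.

Lemma is_derive_kernel (th t z : R) : 0 < t ->
  is_derive (kernel th t) z (kernel_x th t z).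
Proof. intros ht; derive_kernel ht. Qed.

Lemma is_derive_kernel_x (th t z : R) : 0 < t ->
  is_derive (kernel_x th t) z (kernel_xx th t z).
Proof. intros ht; derive_kernel ht. Qed.

Lemma is_derive_kernel_xx (th t z : R) : 0 < t ->
  is_derive (kernel_xx th t) z (kernel_xxx th t z).
Proof. intros ht; derive_kernel ht. Qed.

Lemma is_derive_kernel_xxx (th t z : R) : 0 < t ->
  is_derive (kernel_xxx th t) z (kernel_xxxx th t z).
Proof. intros ht; derive_kernel ht. Qed.

Lemma sin_sub_quarter (a b : R) : sin (a - (b + PI / 2)) = - cos (a - b).
Proof.
replace (a - (b + PI / 2)) with (- (PI / 2 - (a - b))) by ring.
now rewrite sin_neg, sin_shift.
Qed.

Lemma is_derive_amplitude (t : R) : 0 < t ->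
  is_derive (fun s => 1 / sqrt (2 * PI * s)) t
    (- (1 / (2 * t)) * (1 / sqrt (2 * PI * t))).
Proof.
intros ht; assert (hs := sqrt_2PI_mul_pos t ht); assert (h := PI_RGT_0).
assert (e2 : sqrt (2 * PI * t) * sqrt (2 * PI * t) = 2 * PI * t)
  by (apply sqrt_sqrt; nra).
auto_derive; [split; [nra | split; [lra | trivial]] |].
rewrite e2; field; lra.
Qed.

(** The Schroedinger equation [psi_t = (i / 2) psi_zz] in real form; the factor
    [i] is the quarter turn of the phase. *)
Lemma is_derive_kernel_t (th t z : R) : 0 < t ->
  is_derive (fun s => kernel th s z) t (- (1 / 2) * kernel_xx (th + PI / 2) t z).
Proof.
intros ht; assert (hs := sqrt_2PI_mul_pos t ht).
unfold kernel; evar_last.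
{ apply: is_derive_mult; [now apply is_derive_amplitude | | apply Rmult_comm].
  auto_derive; [lra | reflexivity]. }
unfold kernel_xx; rewrite cos_sub_quarter, sin_sub_quarter.
unfold plus, mult; simpl; unfold Rminus, Rdiv; field; lra.
Qed.

Lemma is_derive_kernel_xx_t (th t z : R) : 0 < t ->
  is_derive (fun s => kernel_xx th s z) t
    (- (1 / 2) * kernel_xxxx (th + PI / 2) t z).
Proof.
intros ht; assert (hs := sqrt_2PI_mul_pos t ht).
unfold kernel_xx; evar_last.
{ apply: is_derive_mult; [now apply is_derive_amplitude | | apply Rmult_comm].
  auto_derive; [repeat split; simpl; nra | reflexivity]. }
unfold kernel_xxxx; rewrite cos_sub_quarter, sin_sub_quarter.
unfold plus, mult; simpl; unfold Rminus, Rdiv; field; lra.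
Qed.

Lemma kernel_xxxx_shift_PI (th t z : R) :
  kernel_xxxx (th + PI) t z = - kernel_xxxx th t z.
Proof.
replace (th + PI) with (th + PI / 2 + PI / 2) by field.
unfold kernel_xxxx.
rewrite cos_sub_quarter, !sin_sub_quarter, cos_sub_quarter; ring.
Qed.

(** Differentiability of [Derive_n (F 0) k] needs the closed form [F k] near the
    point, whence the open set. *)
Lemma is_derive_n_of_chain (F : nat -> R -> R) (D : R -> Prop) (n : nat) :
  open D ->
  (forall k x, (k < n)%nat -> D x -> is_derive (F k) x (F (S k) x)) ->
  forall k x, (k <= n)%nat -> D x -> is_derive_n (F 0%nat) k x (F k x).
Proof.
intros hD hF; induction k as [|k IH]; intros x hk hx; [reflexivity |].
simpl; apply (is_derive_ext_loc (F k)); [| now apply hF].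
apply (filter_imp D); [| now apply hD].
intros z hz; symmetry; apply is_derive_n_unique, IH; [lia | exact hz].
Qed.

Lemma ex_derive_n_of_is_derive_n (f : R -> R) (n : nat) (x l : R) :
  is_derive_n f n x l -> ex_derive_n f n x.
Proof. destruct n as [|n]; intros h; [exact I | eexists; exact h]. Qed.

(** * Pairing with test functions *)

Lemma test_function_vanishing (phi : R -> R) (a b : R) (n : nat) (x : R) :
  (forall x, x < a \/ b < x -> phi x = 0) -> x < a \/ b < x ->
  Derive_n phi n x = 0.
Proof.
intros h hx.
assert (hl : locally x (fun z => z < a \/ b < z)).
{ destruct hx as [hx | hx].
  - apply (filter_imp (fun z => z < a)); [tauto | now apply open_lt].
  - apply (filter_imp (fun z => b < z)); [tauto | now apply open_gt]. }
rewrite (Derive_n_ext_loc phi (fun _ => 0)).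
- destruct n as [|n]; [reflexivity | apply Derive_n_const].
- apply: filter_imp hl; exact h.
Qed.

Lemma test_function_C2 (phi : R -> R) (a b A B : R) (n : nat) :
  (forall n x, ex_derive_n phi n x) ->
  (forall x, x < a \/ b < x -> phi x = 0) -> A < a -> b < B ->
  C2_vanishing_at_ends (Derive_n phi n) (Derive_n phi (S n))
    (Derive_n phi (S (S n))) A B.
Proof.
intros hphi h0 hA hB.
assert (hd : forall n x, is_derive (Derive_n phi n) x (Derive_n phi (S n) x)).
{ intros m x; apply Derive_correct, (hphi (S m)). }
assert (hz := fun m x => test_function_vanishing phi a b m x h0).
repeat split; try (apply hz; lra); try apply hd.
intros x; eapply continuous_of_is_derive; apply hd.
Qed.

(** The interval [[A, B]] may reach beyond [0]: this allows the mirror point to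
    be the left end of the domain of integration. *)
Lemma is_RInt_gen_of_support (g : R -> R) (a b A B : R) :
  (forall x, continuous g x) -> (forall x, x < a \/ b < x -> g x = 0) ->
  0 < a -> A < a -> b < B ->
  is_RInt_gen g (at_right 0) (Rbar_locally p_infty) (RInt g A B).
Proof.
intros cg hg ha hA hB.
assert (hz : forall u v, (forall x, Rmin u v < x < Rmax u v -> g x = 0) ->
  is_RInt g u v 0).
{ intros u v h; apply (is_RInt_ext (fun _ => 0)).
  - intros x hx; symmetry; auto.
  - evar_last; [apply: is_RInt_const |].
    unfold scal; simpl; unfold mult; simpl; ring. }
assert (hAB : is_RInt g A B (RInt g A B))
  by (apply: RInt_correct; now apply ex_RInt_of_continuous).
assert (key : forall u v, u < a -> b < v -> is_RInt g u v (RInt g A B)).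
{ intros u v hu hv.
  assert (h1 : is_RInt g u A 0).
  { apply hz; intros x hx; apply hg; left.
    assert (Rmax u A < a) by (apply Rmax_lub_lt; lra); lra. }
  assert (h2 : is_RInt g B v 0).
  { apply hz; intros x hx; apply hg; right.
    assert (b < Rmin B v) by (apply Rmin_glb_lt; lra); lra. }
  assert (h := is_RInt_Chasles _ _ _ _ _ _ (is_RInt_Chasles _ _ _ _ _ _ h1 hAB)
    h2).
  unfold plus in h; simpl in h; rewrite Rplus_0_l, Rplus_0_r in h; exact h. }
apply filterlimi_locally; intros eps.
apply (Filter_prod _ _ _ (fun u => u < a) (fun v => b < v)).
- exists (mkposreal a ha); intros u hu _.
  change (Rabs (u - 0) < a) in hu; apply Rabs_lt_between in hu; lra.
- exists b; auto.
- intros u v hu hv; exists (RInt g A B); split; [now apply key |].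
  apply ball_center.
Qed.

(** * The solution *)

Lemma ua_reflected (y x t : R) : ua y x t = reflected y (kernel (PI / 4) t) x.
Proof. unfold ua, reflected, kernel; ring. Qed.

Lemma ua_is_derive_n_t (y x t : R) (k : nat) : (k <= 2)%nat -> 0 < t ->
  is_derive_n (fun s => ua y x s) k t
    (match k with
     | 0%nat => ua y x t
     | 1%nat => - (1 / 2) * reflected y (kernel_xx (PI / 4 + PI / 2) t) x
     | _ => - (1 / 4) * reflected y (kernel_xxxx (PI / 4) t) x
     end).
Proof.
intros hk ht.
apply (is_derive_n_of_chain (fun k s => match k with
  | 0%nat => ua y x s
  | 1%nat => - (1 / 2) * reflected y (kernel_xx (PI / 4 + PI / 2) s) x
  | _ => - (1 / 4) * reflected y (kernel_xxxx (PI / 4) s) x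
  end) (fun s => 0 < s) 2); [apply open_gt | | exact hk | exact ht].
clear; intros k t hk ht.
assert (k = 0 \/ k = 1)%nat as [-> | ->] by lia.
- apply (is_derive_ext (fun s => reflected y (kernel (PI / 4) s) x)).
  { intros s; symmetry; apply ua_reflected. }
  evar_last.
  { apply: is_derive_minus; now apply is_derive_kernel_t. }
  unfold reflected, minus, plus, opp; simpl; ring.
- evar_last.
  { apply: is_derive_scal; apply: is_derive_minus;
      now apply is_derive_kernel_xx_t. }
  replace (PI / 4 + PI / 2 + PI / 2) with (PI / 4 + PI) by field.
  rewrite !kernel_xxxx_shift_PI.
  unfold reflected, minus, plus, opp, scal; simpl; unfold mult; simpl; field.
Qed.

Lemma ua_is_derive_n_x (y x t : R) (k : nat) : (k <= 4)%nat -> 0 < t ->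
  is_derive_n (fun z => ua y z t) k x
    (reflected y (match k with
     | 0%nat => kernel (PI / 4) t
     | 1%nat => kernel_x (PI / 4) t
     | 2%nat => kernel_xx (PI / 4) t
     | 3%nat => kernel_xxx (PI / 4) t
     | _ => kernel_xxxx (PI / 4) t
     end) x).
Proof.
intros hk ht.
apply (is_derive_n_ext (reflected y (kernel (PI / 4) t))).
{ intros z; symmetry; apply ua_reflected. }
apply (is_derive_n_of_chain (fun k => reflected y (match k with
  | 0%nat => kernel (PI / 4) t
  | 1%nat => kernel_x (PI / 4) t
  | 2%nat => kernel_xx (PI / 4) t
  | 3%nat => kernel_xxx (PI / 4) t
  | _ => kernel_xxxx (PI / 4) t
  end)) (fun _ => True) 4); [apply open_true | | exact hk | exact I].
clear - ht; intros k x hk _.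
assert (k = 0 \/ k = 1 \/ k = 2 \/ k = 3)%nat as [-> | [-> | [-> | ->]]]
  by lia; apply is_derive_reflected; intros z.
- now apply is_derive_kernel.
- now apply is_derive_kernel_x.
- now apply is_derive_kernel_xx.
- now apply is_derive_kernel_xxx.
Qed.

Lemma ua_converges_to_dirac (y : R) : 0 < y ->
  converges_in_distributions (ua y) (dirac y).
Proof.
intros hy phi [hphi [a [b [ha [hab h0]]]]].
set (B := Rmax b y + 1).
assert (hb : b < B) by (unfold B; assert (h := Rmax_l b y); lra).
assert (hyB : y < B) by (unfold B; assert (h := Rmax_r b y); lra).
assert (hC := test_function_C2 phi a b (- y) B 0 hphi h0 ltac:(lra) hb).
exists (fun t => RInt (fun x => reflected y (kernel (PI / 4) t) x * phi x)
  (- y) B); split.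
- intros t ht.
  apply (is_RInt_gen_ext
    (fun x => reflected y (kernel (PI / 4) t) x * phi x)).
  { apply filter_forall; intros _ x _; now rewrite ua_reflected. }
  apply (is_RInt_gen_of_support _ a b); try lra.
  + intros x; apply: continuous_mult; apply continuous_of_ex_derive.
    * eexists; apply is_derive_reflected; intros z.
      now apply is_derive_kernel.
    * apply (hphi 1%nat).
  + intros x hx; rewrite (h0 x hx); ring.
- assert (h := reflected_kernel_limit y (PI / 4) _ _ _ B ltac:(lra) ltac:(lra)
    hC).
  rewrite fresnel_limit_PI4 in h.
  replace (dirac y phi)
    with (2 * (sqrt (2 * PI) / 2) / sqrt (2 * PI) * phi y); [exact h |].
  unfold dirac; assert (hk := sqrt_2PI_pos); field; lra.
Qed.

(** The velocity is [- 1/2] times the second space derivative of the reflected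
    kernel with phase [3 pi/4]. [green_identity] moves that derivative onto
    [phi], and the limit then carries the factor [fresnel_limit (3 pi/4) = 0]. *)
Lemma ua_velocity_converges_to_zero (y : R) : 0 < y ->
  converges_in_distributions (fun x t => Derive (fun s => ua y x s) t)
    zero_distribution.
Proof.
intros hy phi [hphi [a [b [ha [hab h0]]]]].
set (B := Rmax b y + 1).
assert (hb : b < B) by (unfold B; assert (h := Rmax_l b y); lra).
assert (hyB : y < B) by (unfold B; assert (h := Rmax_r b y); lra).
assert (hC0 := test_function_C2 phi a b (- y) B 0 hphi h0 ltac:(lra) hb).
assert (hC2 := test_function_C2 phi a b (- y) B 2 hphi h0 ltac:(lra) hb).
set (th := PI / 4 + PI / 2).
exists (fun t => - (1 / 2) *
  RInt (fun x => reflected y (kernel th t) x * Derive_n phi 2 x) (- y) B); split.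
- intros t ht.
  rewrite <- (green_identity _ _ (reflected y (kernel_xx th t)) _ _ _ _ _
    (fun x => is_derive_reflected _ _ _ x (fun z => is_derive_kernel th t z ht))
    (fun x => is_derive_reflected _ _ _ x
      (fun z => is_derive_kernel_x th t z ht))) with (2 := hC0).
  2: { intros x; apply continuous_of_ex_derive; eexists.
       apply is_derive_reflected; intros z; now apply is_derive_kernel_xx. }
  apply (is_RInt_gen_ext (fun x => scal (- (1 / 2))
    (reflected y (kernel_xx th t) x * phi x))).
  { apply filter_forall; intros _ x _.
    assert (h := ua_is_derive_n_t y x t 1 ltac:(lia) ht).
    rewrite (is_derive_n_unique _ _ _ _ h
      : Derive (fun s : R => ua y x s) t = _).
    unfold scal; simpl; unfold mult; simpl; fold th; ring. }
  apply: is_RInt_gen_scal; apply (is_RInt_gen_of_support _ a b); try lra.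
  + intros x; apply: continuous_mult; apply continuous_of_ex_derive.
    * eexists; apply is_derive_reflected; intros z.
      now apply is_derive_kernel_xx.
    * apply (hphi 1%nat).
  + intros x hx; rewrite (h0 x hx); ring.
- assert (h := reflected_kernel_limit y th _ _ _ B ltac:(lra) ltac:(lra) hC2).
  unfold th in h at 2; rewrite fresnel_limit_3PI4 in h.
  replace (2 * 0 / sqrt (2 * PI) * Derive_n phi 2 y) with 0 in h
    by (unfold Rdiv; ring).
  replace (zero_distribution phi) with (- (1 / 2) * 0)
    by (unfold zero_distribution; ring).
  apply (filterlim_comp _ _ _ _ (fun z => - (1 / 2) * z) _ _ _ h).
  apply: (filterlim_scal_r (- (1 / 2)) 0).
Qed.

Theorem theorem2p1 (y : R) (hy : 0 < y) : is_solution y (ua y).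
Proof.
split.
- intros k x t hk _ ht; eapply ex_derive_n_of_is_derive_n.
  now apply ua_is_derive_n_t.
- intros k x t hk _ ht; eapply ex_derive_n_of_is_derive_n.
  now apply ua_is_derive_n_x.
- intros x t _ ht.
  rewrite (is_derive_n_unique _ _ _ _ (ua_is_derive_n_t y x t 2 ltac:(lia) ht)).
  rewrite (is_derive_n_unique _ _ _ _ (ua_is_derive_n_x y x t 4 ltac:(lia) ht)).
  field.
- now apply ua_converges_to_dirac.
- now apply ua_velocity_converges_to_zero.
- intros t _; unfold ua.
  replace ((0 - y) ^ 2) with ((0 + y) ^ 2) by ring; ring.
- intros t ht.
  assert (e : ua y 0 t = 0).
  { unfold ua; replace ((0 - y) ^ 2) with ((0 + y) ^ 2) by ring; ring. }
  assert (c : continuous (fun x => ua y x t) 0).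
  { apply continuous_of_ex_derive; eexists.
    apply (ua_is_derive_n_x y 0 t 1 ltac:(lia) ht). }
  unfold continuous in c; rewrite e in c.
  exact (filterlim_filter_le_1 _ (filter_le_within _) c).
Qed.
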